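(* Let $0<p<1$ and $\phi:\mathbb{R}^n\to\mathbb{R}$, $\phi(x)=\|x\|_p^p=\sum_{i=1}^n|x_i|^p$. For any $\bar x\in\mathbb{R}^n$, with $\bar{\mathcal N}=\{i\mid \bar x_i\neq 0\}$, it holds that $$\partial\phi(\bar x)=\widehat\partial\phi(\bar x)=\{v\in\mathbb{R}^n\mid v_j=\mathrm{sign}(\bar x_j)\,p\,|\bar x_j|^{p-1},\ j\in\bar{\mathcal N}\},$$ $$[\widehat\partial\phi(\bar x)]^\infty=\partial^\infty\phi(\bar x)=\{v\in\mathbb{R}^n\mid v_j=0,\ j\in\bar{\mathcal N}\}.$$ Therefore, $\phi$ is subdifferentially regular at every $x\in\mathbb{R}^n$.
   Context: For $f:\mathbb{R}^n\to\mathbb{R}\cup\{+\infty\}$ and $\bar x$ with $f(\bar x)<\infty$: $v$ is a regular subgradient, $v\in\widehat\partial f(\bar x)$, if $f(x)\ge f(\bar x)+\langle v,x-\bar x\rangle+o(|x-\bar x|)$; $v$ is a (general) subgradient, $v\in\partial f(\bar x)$, if there are $x^\nu\to\bar x$ with $f(x^\nu)\to f(\bar x)$ and $v^\nu\in\widehat\partial f(x^\nu)$ with $v^\nu\to v$; $v$ is a horizon subgradient, $v\in\partial^\infty f(\bar x)$, if there are $x^\nu\to\bar x$ with $f(x^\nu)\to f(\bar x)$, $v^\nu\in\widehat\partial f(x^\nu)$ and $\lambda^\nu\searrow0$ with $\lambda^\nu v^\nu\to v$. For a nonempty $C\subset\mathbb{R}^n$, its horizon cone is $C^\infty=\{x\mid\exists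 x^\nu\in C,\ \lambda^\nu\searrow0,\ \lambda^\nu x^\nu\to x\}$; $\emptyset^\infty=\{0\}$. For $C\subset\mathbb{R}^n$ and $\bar x\in C$: $v\in\widehat N_C(\bar x)$ (regular normal) if $\limsup_{x\to\bar x,\,x\in C,\,x\ne\bar x}\langle v,x-\bar x\rangle/\|x-\bar x\|\le0$; $v\in N_C(\bar x)$ (general normal) if there are $x^\nu\in C$, $x^\nu\to\bar x$ and $v^\nu\in\widehat N_C(x^\nu)$ with $v^\nu\to v$. $C$ is Clarke regular at $\bar x$ if it is locally closed at $\bar x$ and $N_C(\bar x)=\widehat N_C(\bar x)$. A function $f$ is subdifferentially regular at $\bar x$ if $f(\bar x)$ is finite and its epigraph $\{(x,\alpha)\mid\alpha\ge f(x)\}$ is Clarke regular at $(\bar x,f(\bar x))$. *)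

(* Defs.v *)
From HB Require Import structures.
From mathcomp Require Import all_boot all_order all_algebra.
From mathcomp Require Import all_classical all_reals all_analysis.

Set Implicit Arguments.
Unset Strict Implicit.
Unset Printing Implicit Defensive.

Import Order.TTheory GRing.Theory Num.Theory.
Import numFieldNormedType.Exports.

Local Open Scope classical_set_scope.
Local Open Scope ring_scope.

Section VariationalAnalysis.
Context {R : realType}.

Section Euclidean.
Context {n : nat}.
Implicit Types (u v : 'rV[R]_n).

Definition dotprod u v : R := \sum_i u 0 i * v 0 i.

(* The library norm on ['rV[R]_n] is the sup norm. The topology is the same,
   but quotients and error terms below use the Euclidean norm. *)
Definition enorm u : R := Num.sqrt (dotprod u u).

End Euclidean.

(* A function R^n -> R u {+oo} is represented by a function into [\bar R] that
   does not take the value [-oo]. *)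
Section Subgradients.
Context {n : nat}.
Implicit Types (f : 'rV[R]_n -> \bar R) (x v : 'rV[R]_n).

Definition regular_subdiff f x : set 'rV[R]_n :=
  [set v | f x \is a fin_num /\
    exists r : 'rV[R]_n -> R^o,
      r =o_x ((fun y => enorm (y - x)) : 'rV[R]_n -> R^o) /\
      forall y, (f x + (dotprod v (y - x) + r y)%:E <= f y)%E].

Definition subdiff f x : set 'rV[R]_n :=
  [set v | f x \is a fin_num /\
    exists (xs vs : nat -> 'rV[R]_n),
      [/\ xs @ \oo --> x, f (xs k) @[k --> \oo] --> f x,
          forall k, regular_subdiff f (xs k) (vs k) & vs @ \oo --> v]].

(* Following Rockafellar and Wets, a sequence decreases to 0 in this sense when
   it is positive and tends to 0. Monotonicity is not required; it can always
   be obtained by passing to a subsequence. *)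
Definition pos_to0 (lam : nat -> R) : Prop :=
  (forall k, 0 < lam k) /\ lam @ \oo --> (0 : R).

Definition horizon_subdiff f x : set 'rV[R]_n :=
  [set v | f x \is a fin_num /\
    exists (xs vs : nat -> 'rV[R]_n) (lam : nat -> R),
      [/\ xs @ \oo --> x, f (xs k) @[k --> \oo] --> f x,
          forall k, regular_subdiff f (xs k) (vs k), pos_to0 lam
        & lam k *: vs k @[k --> \oo] --> v]].

Definition horizon_cone (C : set 'rV[R]_n) : set 'rV[R]_n :=
  [set x : 'rV[R]_n | (C !=set0 /\
      exists (xs : nat -> 'rV[R]_n) (lam : nat -> R),
        [/\ forall k, C (xs k), pos_to0 lam
          & lam k *: xs k @[k --> \oo] --> x])
    \/ (C = set0 /\ x = 0)].

End Subgradients.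

Section Normals.
Context {m : nat}.
Implicit Types (C : set 'rV[R]_m) (x v : 'rV[R]_m).

(* At an isolated point of [C] the filter is improper and the limsup is [-oo],
   so every vector is a regular normal. *)
Definition regular_normal C x : set 'rV[R]_m :=
  [set v | C x /\
    (limf_esup (fun y : 'rV[R]_m => (dotprod v (y - x) / enorm (y - x))%:E)
               (within C x^') <= 0)%E].

Definition normal C x : set 'rV[R]_m :=
  [set v | C x /\
    exists (xs vs : nat -> 'rV[R]_m),
      [/\ forall k, C (xs k), xs @ \oo --> x,
          forall k, regular_normal C (xs k) (vs k) & vs @ \oo --> v]].

Definition locally_closed_at C x : Prop :=
  exists V : set 'rV[R]_m, [/\ nbhs x V, closed V & closed (C `&` V)].

Definition clarke_regular C x : Prop :=
  [/\ C x, locally_closed_at C x & normal C x = regular_normal C x].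

End Normals.

Section SubdifferentialRegularity.
Context {n : nat}.

(* R^n x R is identified with R^(n + 1), so that the Euclidean notions above
   apply to epigraphs. *)
Definition epigraph (f : 'rV[R]_n -> \bar R) : set 'rV[R]_(n + 1) :=
  [set z | exists (x : 'rV[R]_n) (a : R),
    z = row_mx x (a%:M : 'rV[R]_1) /\ (f x <= a%:E)%E].

Definition subdiff_regular (f : 'rV[R]_n -> \bar R) (x : 'rV[R]_n) : Prop :=
  f x \is a fin_num /\
  clarke_regular (epigraph f) (row_mx x ((fine (f x))%:M : 'rV[R]_1)).

End SubdifferentialRegularity.

Definition phi (p : R) {n : nat} (x : 'rV[R]_n) : R :=
  \sum_i `|x 0 i| `^ p.

End VariationalAnalysis.

(* Main.v *)
Require Import Defs.
From HB Require Import structures.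
From mathcomp Require Import all_boot all_order all_algebra.
From mathcomp Require Import all_classical all_reals all_analysis.
From mathcomp Require Import ring lra.

Import Order.TTheory GRing.Theory Num.Theory.
Import numFieldNormedType.Exports.

Local Open Scope classical_set_scope.
Local Open Scope ring_scope.

(** The function [phi] is separable, so everything comes from the scalar
function [|s| ^ p].  At [s <> 0] it is differentiable, with derivative
[dabsX p s]; near [0] it dominates every linear function, because
[|t| ^ (p - 1)] blows up there ([near0_absX_ge]).  Hence the coordinate [v_j]
of a regular subgradient at [x] is forced when [x_j <> 0] and completely free
when [x_j = 0]: the regular subdifferential is the affine space
[phi_critical p x] ([regular_subdiff_phi]).

All limiting objects are controlled by one closure argument
([critical_limit]): when [x_j <> 0], the coordinates [x_j^k] of a sequence
converging to [x] are eventually nonzero and [dabsX p] is continuous there, so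
the relation [v_j = l * dabsX p x_j] survives limits in [x], [v] and [l].
With [l = 1] it shows that the general subdifferential is no larger than the
regular one, and with [l -> 0] that horizon subgradients vanish on the support
of [x].  Conversely the recession directions of [phi_critical p x] are the
vectors vanishing on the support, and the horizon cone of the regular
subdifferential always lies inside the horizon subdifferential, so the three
sets coincide.

For subdifferential regularity, the regular normals [(v, - l)] to the epigraph
are described by the same relation.  Moving along the graph in a coordinate
direction [j] with [x_j <> 0], and vertically, shows that every regular normal
at every point of the epigraph, on the graph or above it, has [l >= 0] and
[v_j = l * dabsX p x_j] on the support of [x] ([regular_normal_phi]).  These
conditions pass to the limit.  At a point of the graph they are sufficient
([phi_regular_normal]): for [l > 0] the vector [(v, - l)] is a multiple of
[(w, - 1)] with [w] a regular subgradient, and for [l = 0] it is the limit of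
[(v, 0) + d (g, - 1)] as [d -> 0+], where [g] is any regular subgradient.  So
general normals are regular. *)

Set Implicit Arguments.
Unset Strict Implicit.
Unset Printing Implicit Defensive.

(** * The scalar function [|s| ^ p] *)

Section Scalar.
Context {R : realType}.
Implicit Types (p s t : R).

Lemma is_derive1_estimate (h : R -> R) (s d e : R) :
  is_derive s 1 h d -> 0 < e ->
  \forall t \near s, `|h t - h s - d * (t - s)| <= e * `|t - s|.
Proof.
move=> [hd hE] e0.
have /eqaddoP /(_ e e0) := derivable_nbhs hd.
rewrite hE => H.
rewrite (near_shift 0 s).
apply: filterS H => t /=.
rewrite !fctE /cst /= !subr0 [t%:A]mulr1 addrK [t *: d]mulrC opprD addrA.
exact.
Qed.

(** A linear function bounded above by [o(t)] on both sides of [0] vanishes;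
evaluate at a small [t] having the sign of [c]. *)
Lemma slope_eq0 (c : R) :
  (forall e, 0 < e -> \forall t \near (0 : R), c * t <= e * `|t|) -> c = 0.
Proof.
move=> H; apply/eqP; rewrite -normr_le0; apply/ler_addgt0Pr => e e0.
rewrite add0r.
have /nbhs_ballP[d /= d0 Hd] := H e e0.
pose t := Num.sg c * (d / 2).
have d20 : 0 < d / 2 by rewrite divr_gt0.
have [->|c0] := eqVneq c 0; first by rewrite normr0 ltW.
have tE : `|t| = d / 2 by rewrite normrM normr_sg c0 mul1r gtr0_norm.
have : ball (0 : R) d t by rewrite /ball /= sub0r normrN tE; lra.
by move/Hd; rewrite tE /t mulrA [c * _]mulrC -normrEsg ler_pM2r.
Qed.

(** The derivative of [|s| ^ p] at [s <> 0], with the conventional value [0] at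
[s = 0]. *)
Definition dabsX p s : R := Num.sg s * p * `|s| `^ (p - 1).

Lemma near_sg s : s != 0 -> \forall t \near s, Num.sg t = Num.sg s.
Proof.
move=> s0.
have s0' : 0 < `|s| by rewrite normr_gt0.
near=> t.
have : `|s - t| < `|s| by near: t; exact: cvgr_dist_lt.
case: (ltgtP s 0) s0 => // ss _.
  rewrite (ltr0_norm ss) ltr_norml => /andP[h1 h2].
  by rewrite !ltr0_sg //; lra.
rewrite (gtr0_norm ss) ltr_norml => /andP[h1 h2].
by rewrite !gtr0_sg //; lra.
Unshelve. all: by end_near. Qed.

(** Away from [0], the absolute value coincides locally with a linear function;
this is how differentiability of [|s| ^ p] reduces to that of the power. *)
Lemma near_norm s : s != 0 -> \forall t \near s, Num.sg s * t = `|t|.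
Proof. by move/near_sg; apply: filterS => t <-; rewrite [RHS]normrEsg. Qed.

Lemma is_derive_absX p s :
  s != 0 -> is_derive s 1 (fun t => `|t| `^ p) (dabsX p s).
Proof.
move=> s0.
have sg_gt0 : 0 < Num.sg s * s by rewrite -normrEsg normr_gt0.
apply: (@near_eq_is_derive _ _ _ (fun t => (Num.sg s * t) `^ p)).
  by apply: filterS (near_norm s0) => t ->.
have D1 := @is_derive1_powR R p _ sg_gt0.
have D2 : is_derive s 1 (fun t => Num.sg s * t) (Num.sg s).
  have := @is_deriveZ _ _ _ id (Num.sg s) s 1 1 (is_derive_id _ _).
  by rewrite scaler1.
have := is_derive1_comp D1 D2.
by rewrite -normrEsg mulrC mulrA.
Qed.

Lemma cvg_dabsX p s : s != 0 -> dabsX p t @[t --> s] --> dabsX p s.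
Proof.
move=> s0.
have : Num.sg s * p * `|t| `^ (p - 1) @[t --> s] --> dabsX p s.
  apply: cvgMl_tmp.
  have D := @ex_derive _ _ _ _ _ _ _ (is_derive_absX (p - 1) s0).
  exact: (differentiable_continuous ((derivable1_diffP _ _).1 D)).
apply: cvg_trans; apply: near_eq_cvg.
by apply: filterS (near_sg s0) => t ts; rewrite /dabsX ts.
Qed.

Lemma near0_absX_le p e : 0 < p -> 0 < e -> \forall t \near (0 : R), `|t| `^ p <= e.
Proof.
move=> p0 e0.
have e1 : 0 < e `^ p^-1 by rewrite powR_gt0.
near=> t.
have te : `|t| <= e `^ p^-1 by near: t; exact: cvgr0_norm_le.
have -> : e = (e `^ p^-1) `^ p by rewrite -powRrM mulVf ?gt_eqF// powRr1 ?ltW.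
by apply: ge0_ler_powR te; rewrite ?nnegrE ?powR_ge0 ?normr_ge0 ?ltW.
Unshelve. all: by end_near. Qed.

(** The infinite slope of [|t| ^ p] at the origin: since
[|t| = |t| ^ (1 - p) * |t| ^ p] and [1 - p > 0], the first factor is eventually
at most [1 / K]. *)
Lemma near0_absX_ge p K : p < 1 -> \forall t \near (0 : R), K * `|t| <= `|t| `^ p.
Proof.
move=> p1.
wlog K0 : K / 0 < K.
  move=> W; have : 0 < Num.max K 1 by rewrite lt_max ltr01 orbT.
  move/W; apply: filterS => t; apply: le_trans; apply: ler_wpM2r => //.
  by rewrite le_max lexx.
have Ki : 0 < K^-1 by rewrite invr_gt0.
have q0 : 0 < 1 - p by rewrite subr_gt0.
apply: filterS (near0_absX_le q0 Ki) => t tK.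
have [->|t0] := eqVneq t 0; first by rewrite normr0 mulr0 powR_ge0.
have tE : `|t| = `|t| `^ (1 - p) * `|t| `^ p.
  by rewrite -powRD subrK ?oner_eq0 ?powRr1.
rewrite [in leLHS]tE mulrA ler_piMl ?powR_ge0 //.
by rewrite mulrC -ler_pdivlMr // div1r.
Qed.

Lemma continuous_absX p : 0 < p -> continuous (fun t => `|t| `^ p).
Proof.
move=> p0 s.
have [->|s0] := eqVneq s 0; last first.
  have D := @ex_derive _ _ _ _ _ _ _ (is_derive_absX p s0).
  exact: (differentiable_continuous ((derivable1_diffP _ _).1 D)).
apply/cvgrPdist_le => e e0.
apply: filterS (near0_absX_le p0 e0) => t.
by rewrite normr0 powR0 ?gt_eqF// sub0r normrN [`|_ `^ _|]ger0_norm ?powR_ge0.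
Qed.

(** Both cases of the subgradient inequality at once: at [s <> 0] it is
differentiability, at [s = 0] the infinite slope makes it hold for any [d]. *)
Lemma absX_subgradient p s d e : 0 < p -> p < 1 -> 0 < e -> (s != 0 -> d = dabsX p s) ->
  \forall t \near s, `|s| `^ p + d * (t - s) - e * `|t - s| <= `|t| `^ p.
Proof.
move=> p0 p1 e0 dE.
have [s0|s0] := eqVneq s 0; last first.
  rewrite (dE s0).
  apply: filterS (is_derive1_estimate (is_derive_absX p s0) e0) => t.
  by rewrite ler_norml => /andP[]; lra.
rewrite s0; apply: filterS (near0_absX_ge `|d| p1) => t; apply: le_trans.
rewrite normr0 powR0 ?gt_eqF// add0r subr0 -normrM lerBlDr.
by apply: ler_wpDr (ler_norm _); rewrite mulr_ge0 // ltW.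
Qed.
End Scalar.

(** * Euclidean geometry of row vectors *)

Section Euclid.
Context {R : realType} {n : nat}.
Implicit Types (u v w : 'rV[R]_n).

Lemma dotprodDl u v w : dotprod (u + v) w = dotprod u w + dotprod v w.
Proof. by rewrite -big_split; apply: eq_bigr => i _; rewrite mxE mulrDl. Qed.

Lemma dotprodZl (a : R) u v : dotprod (a *: u) v = a * dotprod u v.
Proof. by rewrite mulr_sumr; apply: eq_bigr => i _; rewrite mxE mulrA. Qed.

Lemma dotprodZr (a : R) u v : dotprod u (a *: v) = a * dotprod u v.
Proof. by rewrite mulr_sumr; apply: eq_bigr => i _; rewrite mxE mulrCA. Qed.

Lemma dotprod0r u : dotprod u 0 = 0.
Proof. by rewrite -(scale0r 0) dotprodZr mul0r. Qed.

Lemma dotprod_delta v j : dotprod v (delta_mx 0 j) = v 0 j.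
Proof.
rewrite /dotprod (bigD1 j) //= mxE !eqxx mulr1 big1 ?addr0 // => i ij.
by rewrite mxE (negbTE ij) andbF mulr0.
Qed.

Lemma dotprod_ge0 u : 0 <= dotprod u u.
Proof. by apply: sumr_ge0 => i _; rewrite -expr2 sqr_ge0. Qed.

Lemma enorm_ge0 u : 0 <= enorm u.
Proof. exact: sqrtr_ge0. Qed.

Lemma enorm0 : enorm (0 : 'rV[R]_n) = 0.
Proof.
by rewrite /enorm dotprod0r sqrtr0.
Qed.

Lemma enormZ (a : R) u : enorm (a *: u) = `|a| * enorm u.
Proof.
by rewrite /enorm dotprodZl dotprodZr mulrA -expr2 sqrtrM ?sqr_ge0 // sqrtr_sqr.
Qed.

Lemma enorm_delta j : enorm (delta_mx 0 j : 'rV[R]_n) = 1.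
Proof. by rewrite /enorm dotprod_delta mxE !eqxx sqrtr1. Qed.

Lemma coord_le_enorm u j : `|u 0 j| <= enorm u.
Proof.
rewrite -sqrtr_sqr ler_wsqrtr // /dotprod (bigD1 j) //= -expr2 lerDl.
by apply: sumr_ge0 => i _; rewrite -expr2 sqr_ge0.
Qed.

Lemma enorm_eq0 u : enorm u = 0 -> u = 0.
Proof.
move=> u0; apply/rowP => j; rewrite mxE; apply/eqP.
by rewrite -normr_le0 -u0 coord_le_enorm.
Qed.

(** A crude substitute for the Cauchy-Schwarz inequality: only the
boundedness of the linear form matters for estimates up to [o(|u|)]. *)
Lemma dotprod_le v u : dotprod v u <= (\sum_i `|v 0 i|) * enorm u.
Proof.
rewrite mulr_suml; apply: ler_sum => i _.
apply: le_trans (ler_norm _) _; rewrite normrM.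
by rewrite ler_wpM2l // coord_le_enorm.
Qed.

Lemma cvg_coord T (F : set_system T) {FF : Filter F} (us : T -> 'rV[R]_n) u j :
  us @ F --> u -> us t 0 j @[t --> F] --> u 0 j.
Proof.
move=> h; have c : {for u, continuous (fun M : 'rV[R]_n => M 0 j : R)}.
  exact: coord_continuous.
exact: cvg_comp _ _ h c.
Qed.

End Euclid.

Section Epigraphical.
Context {R : realType} {n : nat}.
Implicit Types (u v : 'rV[R]_n) (a b : R).

Lemma dotprod_row_mx u v a b :
  dotprod (row_mx u (a%:M : 'rV_1)) (row_mx v (b%:M : 'rV_1)) = dotprod u v + a * b.
Proof.
rewrite /dotprod big_split_ord /= big_ord1; congr (_ + _).
  by apply: eq_bigr => i _; rewrite !row_mxEl.
by rewrite !row_mxEr !mxE.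
Qed.

Lemma enorm_row_mx_ge u a : enorm u <= enorm (row_mx u (a%:M : 'rV_1)).
Proof. by rewrite ler_wsqrtr // dotprod_row_mx lerDl -expr2 sqr_ge0. Qed.

Lemma enorm_row_mx_le u a : enorm (row_mx u (a%:M : 'rV_1)) <= enorm u + `|a|.
Proof.
rewrite -[leRHS]ger0_norm ?addr_ge0 ?enorm_ge0 // -sqrtr_sqr.
rewrite ler_wsqrtr // dotprod_row_mx sqrrD real_normK ?num_real //.
rewrite sqr_sqrtr ?dotprod_ge0 // -expr2 lerD2r lerDl.
by rewrite mulrn_wge0 // mulr_ge0 // enorm_ge0.
Qed.

Lemma row_mx_last (V : 'rV[R]_(n + 1)) :
  V = row_mx (lsubmx V) ((rsubmx V 0 0)%:M : 'rV_1).
Proof. by rewrite -mx11_scalar hsubmxK. Qed.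

Lemma sub_row_mx u v a b :
  row_mx u (a%:M : 'rV_1) - row_mx v (b%:M : 'rV_1) = row_mx (u - v) ((a - b)%:M : 'rV_1).
Proof. by rewrite opp_row_mx add_row_mx raddfB. Qed.

Lemma add_row_mx_scalar u v a b :
  row_mx u (a%:M : 'rV_1) + row_mx v (b%:M : 'rV_1) = row_mx (u + v) ((a + b)%:M : 'rV_1).
Proof. by rewrite add_row_mx raddfD. Qed.

End Epigraphical.

(** * Regular normals and regular subgradients *)

Section Variational.
Context {R : realType}.

(** The point [x] itself may be kept in the neighbourhood, since the inequality
is trivial there. *)
Lemma regular_normalP m (C : set 'rV[R]_m) x v : C x ->
  regular_normal C x v <->
  forall e, 0 < e ->
    \forall y \near x, C y -> dotprod v (y - x) <= e * enorm (y - x).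
Proof.
move=> Cx.
have quot y (e : R) : y != x ->
    ((dotprod v (y - x) / enorm (y - x))%:E <= e%:E)%E =
    (dotprod v (y - x) <= e * enorm (y - x)).
  move=> yx; rewrite lee_fin ler_pdivrMr // lt_neqAle enorm_ge0 andbT eq_sym.
  by apply: contra_neq yx => /enorm_eq0/eqP; rewrite subr_eq0 => /eqP.
split=> [[_ sup0] e e0|H].
  have : (limf_esup (fun y : 'rV[R]_m => (dotprod v (y - x) / enorm (y - x))%:E)
      (within C x^') < e%:E)%E by apply: le_lt_trans sup0 _; rewrite lte_fin.
  move=> /ereal_inf_lt[_ [V nV <-]] supV.
  have : x^' (fun y : 'rV[R]_m => C y -> V y) by exact: nV.
  rewrite /dnbhs /within /=; apply: filterS => y yV Cy.
  have [->|yx] := eqVneq y x.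
    by rewrite subrr enorm0 mulr0 dotprod0r.
  rewrite -quot //; apply: le_trans (ltW supV).
  by apply: ereal_sup_ubound; exists y => //; apply: yV.
split=> //; apply/lee_addgt0Pr => e e0; rewrite add0e.
apply: ge_ereal_inf; exists (ereal_sup
  ((fun y : 'rV[R]_m => (dotprod v (y - x) / enorm (y - x))%:E) @`
   [set y : 'rV[R]_m | y != x /\ dotprod v (y - x) <= e * enorm (y - x)])).
  exists [set y : 'rV[R]_m | y != x /\ dotprod v (y - x) <= e * enorm (y - x)] => //.
  rewrite /within /= /dnbhs /within /=.
  by apply: filterS (H e e0) => y yH yx Cy; split=> //; apply: yH.
by apply: ge_ereal_sup => _ [y [yx yle] <-]; rewrite quot.
Qed.

Lemma regular_subdiffP n (f : 'rV[R]_n -> R) x v :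
  regular_subdiff (EFin \o f) x v <->
  forall e, 0 < e ->
    \forall y \near x, f x + dotprod v (y - x) - e * enorm (y - x) <= f y.
Proof.
split=> [[_ [r [/eqoP ro fr]]] e e0|H].
  apply: filterS (ro e e0) => y.
  rewrite [`|enorm _|]ger0_norm ?enorm_ge0 // ler_norml => /andP[ry _].
  have := fr y; rewrite /= -EFinD lee_fin; apply: le_trans.
  by rewrite -addrA lerD2l lerD2l -mulNr mulNr.
split=> //.
(* The error term: how far [f] falls below its affine minorant. *)
exists (fun y => Num.min 0 (f y - f x - dotprod v (y - x))); split.
  apply/eqoP => e e0; apply: filterS (H e e0) => y Hy.
  rewrite [`|enorm _|]ger0_norm ?enorm_ge0 // ler_norml.
  have e1 : 0 <= e * enorm (y - x) by rewrite mulr_ge0 ?enorm_ge0 ?ltW.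
  by rewrite le_min ge_min oppr_le0 e1 /=; apply/andP; split => //; lra.
move=> y; rewrite /= -EFinD lee_fin.
have : Num.min 0 (f y - f x - dotprod v (y - x)) <= f y - f x - dotprod v (y - x).
  by rewrite ge_min lexx orbT.
lra.
Qed.

Lemma regular_normalZ m (C : set 'rV[R]_m) x v (a : R) : 0 < a ->
  regular_normal C x v -> regular_normal C x (a *: v).
Proof.
move=> a0 vN; have Cx : C x by case: vN.
apply/(regular_normalP _ Cx) => e e0.
have /(regular_normalP _ Cx) /(_ (e / a)) := vN.
rewrite divr_gt0 // => /(_ isT); apply: filterS => y + Cy => /(_ Cy).
by rewrite dotprodZl mulrAC ler_pdivlMr // mulrC.
Qed.

(** The regular normals form a closed cone.  Only limits along a ray are
needed: the perturbation [d *: w] costs at most [d * M * |y - x|], which is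
absorbed in half of the error term. *)
Lemma regular_normal_limit m (C : set 'rV[R]_m) x v w :
  (forall d, 0 < d -> regular_normal C x (v + d *: w)) -> regular_normal C x v.
Proof.
move=> H; have Cx : C x by case: (H 1 ltr01).
apply/(regular_normalP _ Cx) => e e0.
pose M := \sum_i `|(- w) 0 i|.
have M0 : 0 <= M by exact: sumr_ge0.
pose d := e / 2 / (M + 1).
have d0 : 0 < d by rewrite !divr_gt0 // ltr_wpDl.
have dM : d * M <= e / 2.
  by rewrite /d mulrAC ler_pdivrMr ?ltr_wpDl // ler_pM2l ?divr_gt0 // lerDl.
have e20 : 0 < e / 2 by rewrite divr_gt0.
have /(regular_normalP _ Cx) /(_ _ e20) := H d d0.
apply: filterS => y + Cy => /(_ Cy).
rewrite dotprodDl dotprodZl.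
have := dotprod_le (- w) (y - x); rewrite -/M -scaleN1r dotprodZl.
have := enorm_ge0 (y - x).
set N := enorm _; set p := dotprod v _; set q := dotprod w _ => N0 h1 h2.
have h3 : d * - q <= e / 2 * N.
  apply: (@le_trans _ _ (d * (M * N))).
    by rewrite ler_wpM2l ?(ltW d0) // -mulN1r.
  by rewrite mulrA ler_wpM2r.
lra.
Qed.

Lemma epigraphP n (f : 'rV[R]_n -> R) x a :
  epigraph (EFin \o f) (row_mx x (a%:M : 'rV_1)) <-> f x <= a.
Proof.
split=> [[y [b [/eq_row_mx[-> /matrixP/(_ 0 0)]]]]|xa].
  by rewrite !mxE /= !mulr1n => ->; rewrite lee_fin.
by exists x, a; split => //; rewrite lee_fin.
Qed.

Lemma epigraphE n (f : 'rV[R]_n -> R) z :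
  epigraph (EFin \o f) z <-> f (lsubmx z) <= rsubmx z 0 0.
Proof. by rewrite [in epigraph _ _](row_mx_last z) epigraphP. Qed.

(** Going up in the epigraph decreases the inner product with [(v, -1)], so it
suffices to look at the graph, where the inequality is the one that defines a
regular subgradient. *)
Lemma regular_normal_epigraph n (f : 'rV[R]_n -> R) x v :
  regular_subdiff (EFin \o f) x v ->
  regular_normal (epigraph (EFin \o f)) (row_mx x ((f x)%:M : 'rV_1))
    (row_mx v ((-1)%:M : 'rV_1)).
Proof.
move=> /regular_subdiffP H.
have Cx : epigraph (EFin \o f) (row_mx x ((f x)%:M : 'rV_1)) by apply/epigraphP.
apply/(regular_normalP _ Cx) => e e0.
have cl : lsubmx (z : 'rV[R]_(n + 1)) @[z --> row_mx x ((f x)%:M : 'rV_1)] --> x.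
  by rewrite -[X in _ --> X](row_mxKl x ((f x)%:M : 'rV_1)); exact: continuous_lsubmx.
have : \forall z \near row_mx x ((f x)%:M : 'rV_1),
   f x + dotprod v (lsubmx z - x) - e * enorm (lsubmx z - x) <= f (lsubmx z).
  exact: cl _ (H e e0).
apply: filterS => z + /epigraphE.
rewrite [in dotprod _ (z - _)](row_mx_last z) [in enorm (z - _)](row_mx_last z).
rewrite !sub_row_mx dotprod_row_mx mulN1r.
set u := lsubmx z; set b := rsubmx z 0 0 => h1 h2.
have : e * enorm (u - x) <= e * enorm (row_mx (u - x) ((b - f x)%:M : 'rV_1)).
  by rewrite ler_wpM2l ?(ltW e0) // enorm_row_mx_ge.
lra.
Qed.

Lemma locally_closed_epigraph n (f : 'rV[R]_n -> R) z :
  continuous f -> locally_closed_at (epigraph (EFin \o f)) z.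
Proof.
move=> cf; exists setT; split=> //; first exact: filterT.
rewrite setIT.
have -> : epigraph (EFin \o f) =
    (fun z => rsubmx z 0 0 - f (lsubmx z)) @^-1` [set a | 0 <= a].
  by apply/seteqP; split=> y /=; rewrite epigraphE subr_ge0.
suff cg : continuous (fun z : 'rV[R]_(n + 1) => rsubmx z 0 0 - f (lsubmx z)).
  by apply: preimage_closed; [move=> y _; exact: cg | exact: closed_ge].
move=> y.
have c1 : rsubmx (z : 'rV[R]_(n + 1)) @[z --> y] --> (rsubmx y : 'rV[R]_1).
  exact: continuous_rsubmx.
have c2 : lsubmx (z : 'rV[R]_(n + 1)) @[z --> y] --> (lsubmx y : 'rV[R]_n).
  exact: continuous_lsubmx.
have c3 : {for (rsubmx y : 'rV[R]_1), continuous (fun M : 'rV[R]_1 => M 0 0 : R)}.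
  exact: coord_continuous.
exact: cvgB (cvg_comp _ _ c1 c3) (cvg_comp _ _ c2 (cf _)).
Qed.
End Variational.

(** * Subdifferentials and normals of [phi] *)

Section Quasinorm.
Context {R : realType} {n : nat} (p : R).
Implicit Types (x y v : 'rV[R]_n).

Definition grad_phi x : 'rV[R]_n := \row_j dabsX p (x 0 j).

Definition phi_critical x : set 'rV[R]_n :=
  [set v | forall j, x 0 j != 0 -> v 0 j = dabsX p (x 0 j)].

Lemma grad_phi_critical x : phi_critical x (grad_phi x).
Proof. by move=> j _; rewrite mxE. Qed.

Lemma phi_add_delta x j (t : R) :
  phi p (x + t *: delta_mx 0 j) = phi p x + (`|x 0 j + t| `^ p - `|x 0 j| `^ p).
Proof.
rewrite /phi (bigD1 j) //= [in RHS](bigD1 j) //= !mxE !eqxx mulr1.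
rewrite (eq_bigr (fun i => `|x 0 i| `^ p)); first ring.
by move=> i ij; rewrite !mxE (negbTE ij) andbF mulr0 addr0.
Qed.

(** The closure argument shared by general subgradients ([ls = 1]), horizon
subgradients ([ls] tending to [0]) and general normals ([ls] the opposite of
the last coordinate).  Nothing is claimed about the coordinates where [x]
vanishes: there the slopes [dabsX p (xs k 0 j)] may be unbounded. *)
Lemma critical_limit (xs vs : nat -> 'rV[R]_n) (ls : nat -> R) x v (l : R) :
  xs @ \oo --> x -> vs @ \oo --> v -> ls @ \oo --> l ->
  (forall k j, xs k 0 j != 0 -> vs k 0 j = ls k * dabsX p (xs k 0 j)) ->
  forall j, x 0 j != 0 -> v 0 j = l * dabsX p (x 0 j).
Proof.
move=> xsx vsv lsl H j xj.
have cx : xs k 0 j @[k --> \oo] --> x 0 j by exact: cvg_coord xsx.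
have cv : vs k 0 j @[k --> \oo] --> v 0 j by exact: cvg_coord vsv.
have cg : ls k * dabsX p (xs k 0 j) @[k --> \oo] --> l * dabsX p (x 0 j).
  have cd : dabsX p (xs k 0 j) @[k --> \oo] --> dabsX p (x 0 j).
    have c := cvg_dabsX (p := p) xj.
    exact: cvg_comp _ _ cx c.
  exact: cvgM lsl cd.
apply: (cvg_unique (@Rhausdorff R) cv); apply: cvg_trans cg.
apply: near_eq_cvg; have : \forall k \near \oo, xs k 0 j != 0.
  exact: cvgr_neq0 cx xj.
by apply: filterS => k /H ->.
Qed.

(** Test the normal along curves inside the epigraph: the vertical ray gives the
sign of [l], and the two directions of the curve
[t |-> (x + t e_j, a + |x_j + t| ^ p - |x_j| ^ p)], differentiable at [t = 0],
give the equality.  The curve lies in a vertical translate of the graph, so the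
argument applies to all [a], on the graph or above it. *)
Lemma regular_normal_phi x (a : R) v (l : R) :
  regular_normal (epigraph (EFin \o phi p)) (row_mx x (a%:M : 'rV_1))
    (row_mx v ((- l)%:M : 'rV_1)) ->
  0 <= l /\ forall j, x 0 j != 0 -> v 0 j = l * dabsX p (x 0 j).
Proof.
move=> vN; have Cx : epigraph (EFin \o phi p) (row_mx x (a%:M : 'rV_1)) by case: vN.
have /epigraphP xa := Cx.
have {}vN := (regular_normalP _ Cx).1 vN.
(* The normal inequality along a curve [(x + t u, a + g t)] that stays in the
   epigraph. *)
have path (u : 'rV[R]_n) (g : R -> R) e : 0 < e -> g t @[t --> 0] --> (0 : R) ->
  \forall t \near (0 : R), phi p (x + t *: u) <= a + g t ->
    t * dotprod v u - l * g t <= e * (`|t| * enorm u + `|g t|).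
  move=> e0 g0.
  pose z t := row_mx x (a%:M : 'rV_1) + t *: row_mx u (0 : 'rV[R]_1)
       + g t *: row_mx (0 : 'rV[R]_n) (1%:M : 'rV[R]_1).
  have zE t : z t = row_mx (x + t *: u) ((a + g t)%:M : 'rV_1).
    rewrite /z !scale_row_mx !add_row_mx !scaler0 !addr0 scale_scalar_mx mulr1.
    by rewrite -raddfD.
  have cz : z @ (0 : R) --> row_mx x (a%:M : 'rV_1).
    have c0 : t @[t --> (0 : R)] --> (0 : R) by exact: cvg_id.
    have c1 : t *: row_mx u (0 : 'rV[R]_1) @[t --> (0 : R)]
        --> (0 : R) *: row_mx u (0 : 'rV[R]_1) by exact: cvgZr_tmp c0.
    have c2 : g t *: row_mx (0 : 'rV[R]_n) (1%:M : 'rV[R]_1) @[t --> (0 : R)]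
        --> (0 : R) *: row_mx (0 : 'rV[R]_n) (1%:M : 'rV[R]_1) by exact: cvgZr_tmp g0.
    have : z @ (0 : R) --> row_mx x (a%:M : 'rV_1) + (0 : R) *: row_mx u (0 : 'rV[R]_1)
        + (0 : R) *: row_mx (0 : 'rV[R]_n) (1%:M : 'rV[R]_1).
      by apply: cvgD => //; apply: cvgD => //; exact: cvg_cst.
    by rewrite !scale0r !addr0.
  have : \forall t \near (0 : R), epigraph (EFin \o phi p) (z t) ->
      dotprod (row_mx v ((- l)%:M : 'rV_1)) (z t - row_mx x (a%:M : 'rV_1)) <=
      e * enorm (z t - row_mx x (a%:M : 'rV_1)) by exact: cz _ (vN e e0).
  apply: filterS => t; rewrite zE epigraphP => h /h.
  rewrite sub_row_mx dotprod_row_mx [x + _]addrC [a + _]addrC !addrK dotprodZr mulNr.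
  move=> /le_trans; apply; rewrite ler_wpM2l ?(ltW e0) //.
  apply: le_trans (enorm_row_mx_le _ _) _.
  by rewrite lerD2r enormZ.
split.
  rewrite -oppr_le0; apply/ler_addgt0Pr => e e0; rewrite add0r.
  have /nbhs_ballP[d /= d0 Hd] := path 0 id e e0 cvg_id.
  have d20 : 0 < d / 2 by rewrite divr_gt0.
  have : ball (0 : R) d (d / 2).
    by rewrite /ball /= sub0r normrN gtr0_norm //; lra.
  move/Hd; rewrite scaler0 addr0 dotprod0r enorm0 !mulr0 !add0r.
  by rewrite gtr0_norm // -mulNr ler_pM2r //; apply; lra.
move=> j xj; apply/eqP; rewrite -subr_eq0; apply/eqP.
set d := dabsX p _; set s := x 0 j in xj d *.
have D := is_derive_absX p xj; rewrite -/s -/d in D.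
pose h t := `|s + t| `^ p - `|s| `^ p.
have h0 : h t @[t --> 0] --> (0 : R).
  rewrite -[X in _ --> X](subrr (`|s| `^ p)); apply: cvgB; last exact: cvg_cst.
  have cs : s + t @[t --> 0] --> s.
    by rewrite -[X in _ --> X]addr0; apply: cvgD; [exact: cvg_cst|exact: cvg_id].
  have := @ex_derive _ _ _ _ _ _ _ D.
  by move=> /derivable1_diffP /differentiable_continuous; exact: cvg_comp _ _ cs.
apply: slope_eq0 => e e0.
(* [C] collects the errors coming from the normal inequality and from the
   first-order expansion of [h], both taken with tolerance [e1 <= 1]. *)
pose C := 2 + `|d| + `|l|.
have C0 : 0 < C by rewrite /C ltr_pwDl // ltr_pwDl.
pose e1 := Num.min 1 (e / C).
have e10 : 0 < e1 by rewrite lt_min ltr01 divr_gt0.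
have e11 : e1 <= 1 by rewrite ge_min lexx.
have e1C : e1 * C <= e by rewrite -ler_pdivlMr // ge_min lexx orbT.
have := is_derive1_estimate D e10.
rewrite (near_shift 0 s) => near_h.
apply: filterS2 near_h (path (delta_mx 0 j) h _ e10 h0) => t /=.
rewrite subr0 -{1}[t + s]addrC addrK phi_add_delta -/s -/(h t) lerD2r => h1 /(_ xa).
rewrite dotprod_delta enorm_delta mulr1 => h2.
have h3 : `|h t| <= (`|d| + e1) * `|t|.
  rewrite -[h t](subrK (d * t)) addrC mulrDl; apply: le_trans (ler_normD _ _) _.
  by rewrite normrM lerD2l.
have h4 : l * (h t - d * t) <= `|l| * (e1 * `|t|).
  by apply: le_trans (ler_norm _) _; rewrite normrM ler_wpM2l.
have h5 : e1 * `|h t| <= e1 * ((`|d| + 1) * `|t|).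
  rewrite ler_pM2l //; apply: le_trans h3 _; rewrite ler_wpM2r //; lra.
have h6 : e1 * C * `|t| <= e * `|t| by rewrite ler_wpM2r.
rewrite /C in h6; lra.
Qed.
Lemma continuous_phi : 0 < p -> continuous (phi p : 'rV[R]_n -> R).
Proof.
move=> p0 x; rewrite /phi.
apply: (@cvg_big _ _ +%R 0 xpredT _ _ (nbhs x) _ (fun i (y : 'rV[R]_n) => `|y 0 i| `^ p)).
  exact: add_continuous.
move=> i _.
have ci : (y : 'rV[R]_n) 0 i @[y --> x] --> x 0 i by exact: coord_continuous.
have cp : {for x 0 i, continuous (fun t => `|t| `^ p)} by exact: continuous_absX.
exact: (cvg_comp (fun y : 'rV[R]_n => y 0 i) (fun t => `|t| `^ p) ci cp).
Qed.

Lemma phi_subgradient x v : 0 < p -> p < 1 ->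
  phi_critical x v -> regular_subdiff (EFin \o phi p) x v.
Proof.
move=> p0 p1 xv; apply/regular_subdiffP => e e0.
(* Each of the [n] coordinates gets its share of the tolerance; [n.+1] keeps the
   quotient positive when [n = 0]. *)
pose e1 := e / n.+1%:R.
have e10 : 0 < e1 by rewrite divr_gt0 // ltr0n.
have H : nbhs x (fun y : 'rV[R]_n => forall j : 'I_n,
    `|x 0 j| `^ p + v 0 j * (y 0 j - x 0 j) - e1 * `|y 0 j - x 0 j|
    <= `|y 0 j| `^ p).
  apply: (@filter_forall _ _ _ _ (nbhs_filter x)) => j.
  have cj : (y : 'rV[R]_n) 0 j @[y --> x] --> x 0 j by exact: coord_continuous.
  exact: cj _ (absX_subgradient p0 p1 e10 (xv j)).
apply: filterS H => y H.
rewrite lerBlDr -lerBlDl.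
have : \sum_(j < n) (v 0 j * (y 0 j - x 0 j)) <=
    \sum_(j < n) (`|y 0 j| `^ p - `|x 0 j| `^ p + e1 * enorm (y - x)).
  apply: ler_sum => j _.
  have := H j; have := coord_le_enorm (y - x) j; rewrite !mxE => h1 h2.
  have h3 : e1 * `|y 0 j - x 0 j| <= e1 * enorm (y - x) by rewrite ler_pM2l.
  lra.
rewrite big_split sumrB /= sumr_const card_ord.
have -> : \sum_(j < n) (v 0 j * (y 0 j - x 0 j)) = dotprod v (y - x).
  by apply: eq_bigr => j _; rewrite !mxE.
rewrite -/(phi p x) -/(phi p y).
have : e1 * enorm (y - x) *+ n <= e * enorm (y - x).
  rewrite -mulrnAl ler_wpM2r ?enorm_ge0 // -mulr_natr /e1 mulrAC ler_pdivrMr ?ltr0n //.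
  by rewrite ler_pM2l // ler_nat.
lra.
Qed.

(** Necessity is read off the epigraph: a regular subgradient [v] gives the
regular normal [(v, -1)], that is, the case [l = 1]. *)
Lemma regular_subdiff_phi x : 0 < p -> p < 1 ->
  regular_subdiff (EFin \o phi p) x = phi_critical x.
Proof.
move=> p0 p1; apply/seteqP; split=> v; last exact: phi_subgradient.
move=> /regular_normal_epigraph /regular_normal_phi[_ H] j xj.
by rewrite (H j xj) mul1r.
Qed.

(** For [l > 0], rescale to last coordinate [-1].  The case [l = 0] is reached by
adding a small multiple of the normal [(grad_phi x, -1)], which makes the
multiplier positive and preserves the relation on the support. *)
Lemma phi_regular_normal x v (l : R) : 0 < p -> p < 1 -> 0 <= l ->
  (forall j, x 0 j != 0 -> v 0 j = l * dabsX p (x 0 j)) ->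
  regular_normal (epigraph (EFin \o phi p)) (row_mx x ((phi p x)%:M : 'rV_1))
    (row_mx v ((- l)%:M : 'rV_1)).
Proof.
move=> p0 p1.
have pos (w : 'rV[R]_n) m : 0 < m ->
  (forall j, x 0 j != 0 -> w 0 j = m * dabsX p (x 0 j)) ->
  regular_normal (epigraph (EFin \o phi p)) (row_mx x ((phi p x)%:M : 'rV_1))
    (row_mx w ((- m)%:M : 'rV_1)).
  move=> m0 wE.
  have -> : row_mx w ((- m)%:M : 'rV_1) = m *: row_mx (m^-1 *: w) ((-1)%:M : 'rV_1).
    by rewrite scale_row_mx scalerA mulfV ?gt_eqF // scale1r scale_scalar_mx mulrN1.
  apply: regular_normalZ => //; apply/regular_normal_epigraph/phi_subgradient => // j xj.
  by rewrite mxE wE // mulKf // gt_eqF.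
move=> l0 vE.
apply: (@regular_normal_limit _ _ _ _ _ (row_mx (grad_phi x) ((-1)%:M : 'rV_1))) => d d0.
rewrite scale_row_mx scale_scalar_mx add_row_mx_scalar mulrN1 -opprD.
apply: pos => [|j xj]; first by rewrite ltr_wpDl.
by rewrite !mxE vE // mulrDl.
Qed.

Lemma subdiff_phi x : 0 < p -> p < 1 ->
  subdiff (EFin \o phi p) x = phi_critical x.
Proof.
move=> p0 p1; apply/seteqP; split=> v.
  move=> [_ [xs [vs [xsx _ vsS vsv]]]] j xj.
  have c1 : (fun _ : nat => 1 : R) @ \oo --> (1 : R) by exact: cvg_cst.
  rewrite -[RHS]mul1r; apply: (critical_limit xsx vsv c1) xj => k i.
  by rewrite mul1r; have := vsS k; rewrite regular_subdiff_phi //; apply.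
move=> vx; split=> //; exists (fun=> x), (fun=> v); split; try exact: cvg_cst.
by move=> k; exact: phi_subgradient.
Qed.

Definition zero_on_support x : set 'rV[R]_n :=
  [set v | forall j, x 0 j != 0 -> v 0 j = 0].

Lemma horizon_subdiff_phi_sub x : 0 < p -> p < 1 ->
  horizon_subdiff (EFin \o phi p) x `<=` zero_on_support x.
Proof.
move=> p0 p1 v [_ [xs [vs [lam [xsx _ vsS [_ lam0] vsv]]]]] j xj.
rewrite (critical_limit xsx vsv lam0 _ xj) ?mul0r // => k i xki.
by rewrite mxE; have := vsS k; rewrite regular_subdiff_phi // => ->.
Qed.

(** Take the base points constant in the definition of a horizon subgradient.
Nonemptiness matters: the horizon cone of the empty set is [{0}]. *)
Lemma horizon_cone_sub_horizon_subdiff (f : 'rV[R]_n -> \bar R) x :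
  f x \is a fin_num -> regular_subdiff f x !=set0 ->
  horizon_cone (regular_subdiff f x) `<=` horizon_subdiff f x.
Proof.
move=> fx [w wS] v [[_ [vs [lam [vsS lam0 vsv]]]]|[S0]]; last by rewrite S0 in wS.
by split=> //; exists (fun=> x), vs, lam; split=> //; exact: cvg_cst.
Qed.

(** The affine space [phi_critical x] contains the ray from [grad_phi x] in the
direction [v]; the points [(k + 1) v + grad_phi x], rescaled by [1 / (k + 1)],
tend to [v]. *)
Lemma zero_on_support_sub_horizon_cone x :
  zero_on_support x `<=` horizon_cone (phi_critical x).
Proof.
move=> v vx; left; split; first by exists (grad_phi x); exact: grad_phi_critical.
exists (fun k => k.+1%:R *: v + grad_phi x), (fun k => k.+1%:R^-1); split.
- by move=> k j xj; rewrite !mxE vx // mulr0 add0r.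
- by split=> [k|]; [rewrite invr_gt0 ltr0n | exact: cvg_harmonic].
have -> : (fun k => k.+1%:R^-1 *: (k.+1%:R *: v + grad_phi x)) =
          (fun k => v + (k.+1%:R^-1 : R) *: grad_phi x).
  by apply/funext => k; rewrite scalerDr scalerA mulVf ?scale1r // pnatr_eq0.
have c : (k.+1%:R^-1 : R) *: grad_phi x @[k --> \oo] --> (0 : R) *: grad_phi x.
  by apply: cvgZr_tmp; exact: cvg_harmonic.
rewrite -[X in _ --> X]addr0 -(scale0r (grad_phi x)).
by apply: cvgD => //; exact: cvg_cst.
Qed.

(** The nontrivial inclusion: coordinates of regular normals at nearby points of
the epigraph satisfy closed relations, which are sufficient at the limit since
the limit point lies on the graph. *)
Lemma subdiff_regular_phi x : 0 < p -> p < 1 ->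
  subdiff_regular (EFin \o phi p) x.
Proof.
move=> p0 p1; split=> //.
set C := epigraph _; set z := row_mx _ _.
have Cz : C z by apply/epigraphP.
split=> //; first exact: locally_closed_epigraph (continuous_phi p0).
apply/seteqP; split=> V; last first.
  move=> VN; split=> //; exists (fun=> z), (fun=> V).
  by split=> //; exact: cvg_cst.
move=> [_ [zs [Vs [Czs zsz VsN VsV]]]].
pose ls k := - rsubmx (Vs k) 0 0; pose l := - rsubmx V 0 0.
have lsP k := regular_normal_phi (x := lsubmx (zs k)) (a := rsubmx (zs k) 0 0)
  (v := lsubmx (Vs k)) (l := ls k).
have {}lsP k : 0 <= ls k /\ forall j, lsubmx (zs k) 0 j != 0 ->
    lsubmx (Vs k) 0 j = ls k * dabsX p (lsubmx (zs k) 0 j).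
  by apply: lsP; rewrite /ls opprK -!row_mx_last; exact: VsN.
have lsl : ls @ \oo --> l.
  have c : rsubmx (Vs k) 0 0 @[k --> \oo] --> rsubmx V 0 0.
    by apply: cvg_coord; apply: cvg_comp VsV _; exact: continuous_rsubmx.
  exact: cvgN c.
have xsx : lsubmx (zs k) @[k --> \oo] --> x.
  rewrite -(row_mxKl x ((phi p x)%:M : 'rV_1)).
  by apply: cvg_comp zsz _; exact: continuous_lsubmx.
have vsv : lsubmx (Vs k) @[k --> \oo] --> lsubmx V.
  by apply: cvg_comp VsV _; exact: continuous_lsubmx.
rewrite (row_mx_last V) -[rsubmx V 0 0]opprK -/l.
apply: phi_regular_normal => //.
  rewrite -(cvg_lim (@Rhausdorff R) lsl); apply: limr_ge; first exact: cvgP lsl.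
  by apply: nearW => k; case: (lsP k).
by apply: critical_limit xsx vsv lsl _ => k; case: (lsP k).
Qed.

End Quasinorm.

Unset Implicit Arguments.

Theorem theorem2p1 (R : realType) (n : nat) (p : R) (hp0 : 0 < p) (hp1 : p < 1) :
  let f : 'rV[R]_n -> \bar R := fun x => (phi p x)%:E in
  (forall xbar : 'rV[R]_n,
    let N := [set i : 'I_n | xbar 0 i != 0] in
    [/\ subdiff f xbar = regular_subdiff f xbar,
        regular_subdiff f xbar =
          [set v : 'rV[R]_n | forall j, N j ->
             v 0 j = Num.sg (xbar 0 j) * p * `|xbar 0 j| `^ (p - 1)],
        horizon_cone (regular_subdiff f xbar) = horizon_subdiff f xbar
      & horizon_subdiff f xbar =
          [set v : 'rV[R]_n | forall j, N j -> v 0 j = 0]]) /\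
  (forall x : 'rV[R]_n, subdiff_regular f x).
Proof.
move=> f; split=> [x N|x]; last exact: subdiff_regular_phi.
have SE : regular_subdiff f x = phi_critical p x by exact: regular_subdiff_phi.
have cone_sub : horizon_cone (regular_subdiff f x) `<=` horizon_subdiff f x.
  apply: horizon_cone_sub_horizon_subdiff => //.
  by rewrite SE; exists (grad_phi p x); exact: grad_phi_critical.
have sub_zero : horizon_subdiff f x `<=` zero_on_support x.
  exact: horizon_subdiff_phi_sub.
have zero_sub : zero_on_support x `<=` horizon_cone (regular_subdiff f x).
  by rewrite SE; exact: zero_on_support_sub_horizon_cone.
split.
- by rewrite SE; exact: subdiff_phi.
- exact: SE.
- by apply/seteqP; split=> // v /sub_zero /zero_sub.
- by apply/seteqP; split=> // v /zero_sub /cone_sub.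
Qed.
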